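(* Let $n\geq 1$ and let $x=(x_i)_{i\in I}$ be a probability distribution on a totally ordered set $I$. Let $w\in\mathfrak{S}_n$. The probability $\mathrm{Prob}(w)$ that a permutation in $\mathfrak{S}_n$ chosen from the QS$(x)$-distribution is equal to $w$ is given by $$\mathrm{Prob}(w)=L_{\mathrm{co}(w^{-1})}(x).$$
   Context: Let $I$ be a totally ordered set and $x=(x_i)_{i\in I}$ with $x_i\ge 0$ and $\sum_{i\in I}x_i=1$ (a discrete probability distribution on $I$). QS$(x)$-distribution on $\mathfrak{S}_n$: choose $i_1,\dots,i_n\in I$ independently, each equal to $i$ with probability $x_i$, and let $w=w_1\cdots w_n\in\mathfrak{S}_n$ be the standardization of the sequence $i_1\cdots i_n$. That is, if $\alpha_1<\cdots<\alpha_k$ are the elements of $I$ that actually appear and $\alpha_r$ appears $a_r$ times, replace the $\alpha_1$'s by $1,2,\dots,a_1$ from left to right, then the $\alpha_2$'s by $a_1+1,\dots,a_1+a_2$ from left to right, etc. For example $311431$ standardizes to $412653$. Descents and compositions: $D(w)=\{i : 1\le i\le n-1,\ w_i>w_{i+1}\}$. For a composition $\alpha=(\alpha_1,\dots,\alpha_k)$ of $n$ (positive integers with sum $n$) put $S_\alpha=\{\alpha_1,\alpha_1+\alpha_2,\dots,\alpha_1+\cdots+\alpha_{k-1}\}\subseteq\{1,\dots,n-1\}$. $\mathrm{co}(w)$ is the unique composition of $n$ with $S_{\mathrm{co}(w)}=D(w)$. Fundamental quasisymmetric function: $$L_\alpha(x)=\sum x_{i_1}x_{i_2}\cdots x_{i_n},$$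 summed over all $i_1\le i_2\le\cdots\le i_n$ in $I$ such that $i_j<i_{j+1}$ whenever $j\in S_\alpha$. Since $x_i\ge0$ and $\sum x_i=1$, this series converges absolutely. *)

(* Defs.v *)
From HB Require Import structures.
From mathcomp Require Import all_boot all_order all_algebra all_fingroup.
From mathcomp Require Import all_classical all_reals all_analysis.

Set Implicit Arguments.
Unset Strict Implicit.
Unset Printing Implicit Defensive.

Import Order.TTheory GRing.Theory Num.Theory.

Local Open Scope classical_set_scope.
Local Open Scope ring_scope.

(* The sum over the possibly uncountable set I is the supremum of the finite
   partial sums, which is the right notion for nonnegative terms. *)
Record ddistr (R : realType) (I : choiceType) := DDistr {
  mass :> I -> R ;
  mass_ge0 : forall i, 0 <= mass i ;
  mass_sum1 : (\esum_(i in [set: I]) (mass i)%:E = 1)%E }.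

Section Words.
Variables (R : realType) (I : choiceType).

Definition word_mass (x : I -> R) n (u : n.-tuple I) : R :=
  \prod_(j < n) x (tnth u j).

(* The sample space I^n. The parameter x is only there to make the type
   canonically pointed, hence measurable: I is nonempty as x has mass 1. The
   sigma-algebra is discrete; for a large I it is finer than the product one. *)
Definition sample (x : ddistr R I) (n : nat) : Type := n.-tuple I.

Lemma ddistr_inh (x : ddistr R I) : exists _ : I, True.
Proof.
apply: contrapT => noI.
have I0 : [set: I] = set0.
  by rewrite -subset0 => i _; apply: noI; exists i.
have := mass_sum1 x; rewrite I0 esum_set0 => /eqP.
by rewrite eq_sym onee_eq0.
Qed.

HB.instance Definition _ x n := Choice.on (sample x n).
HB.instance Definition _ x n :=
  isPointed.Build (sample x n) [tuple of nseq n (projT1 (cid (ddistr_inh x)))].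
HB.instance Definition _ x n := @isMeasurable.Build default_measure_display
  (sample x n) discrete_measurable discrete_measurable0
  discrete_measurableC discrete_measurableU.

(* The law of a sequence of n independent letters with law x; see
   [iid_letter] and [iid_independent]. *)
Definition iid (x : ddistr R I) (n : nat) (A : set (sample x n)) : \bar R :=
  (\esum_(u in (A : set (n.-tuple I))) (word_mass x u)%:E)%E.

Lemma word_mass_ge0 (x : ddistr R I) n (u : n.-tuple I) : 0 <= word_mass x u.
Proof. by apply: prodr_ge0 => j _; exact: mass_ge0. Qed.

Lemma esumZ (T : choiceType) (A : set T) (c : R) (f : T -> \bar R) :
  0 <= c -> (forall i, 0 <= f i)%E ->
  (\esum_(i in A) (c%:E * f i) = c%:E * \esum_(i in A) f i)%E.
Proof.
move=> c0 f0; rewrite /esum -ereal_supZl//; last first.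
  by apply/set0P; exists (\sum_(x \in set0) f x)%E; exists set0 => //; exact: fsets_set0.
congr ereal_sup; rewrite image_comp; apply: eq_imagel => /= X [finX _].
by rewrite fsbig_finite// [in RHS]fsbig_finite// ge0_sume_distrr.
Qed.

Lemma iid_rect (x : ddistr R I) n (A : 'I_n -> set I) :
  (iid [set u : sample x n | forall j, A j (tnth (u : n.-tuple I) j)]
   = \prod_(j < n) \esum_(i in A j) (x i)%:E)%E.
Proof.
rewrite /iid; elim: n A => [|n IH] A.
  rewrite big_ord0 (_ : [set u | _] = [set [tuple]]); last first.
    by apply/seteqP; split=> u //= _; rewrite ?tuple0//; case.
  by rewrite esum_set1 /word_mass big_ord0// lee_fin.
rewrite big_ord_recl -(IH (fun j => A (lift ord0 j))).
pose B := [set t : n.-tuple I | forall j, A (lift ord0 j) (tnth t j)].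
rewrite (reindex_esum (A ord0 `*`` (fun=> B)) _
  (fun k : I * n.-tuple I => cons_tuple k.1 k.2)); last first.
  split.
  - move=> [i t] [/= Ai Bt] j; case: (unliftP ord0 j) => [k ->|->].
      by rewrite tnthS; exact: Bt.
    by rewrite tnth0.
  - move=> [i t] [i' t'] _ _ /(congr1 val)/= [-> /val_inj ->] //.
  - move=> u /= Au; exists (thead u, behead_tuple u); last first.
      by rewrite /=; apply/val_inj; rewrite /= {3}(tuple_eta u).
    split=> [/=|/= j]; first exact: Au.
    have := Au (lift ord0 j); rewrite {1}(tuple_eta u) tnthS.
    by congr (A _ (tnth _ _)); apply/val_inj.
transitivity (\esum_(i in A ord0) \esum_(t in B) ((x i)%:E * (word_mass x t)%:E))%E.
  rewrite esum_esum; last by move=> *; rewrite mule_ge0 ?lee_fin ?mass_ge0 ?word_mass_ge0.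
  apply: eq_esum => -[i t] _ /=; rewrite /word_mass big_ord_recl tnth0 -EFinM.
  by congr (_ * _)%:E; apply: eq_bigr => j _; rewrite tnthS.
transitivity (\esum_(i in A ord0) ((\esum_(t in B) (word_mass x t)%:E) * (x i)%:E))%E.
  apply: eq_esum => i _; rewrite esumZ ?mass_ge0 //; first by rewrite muleC.
  by move=> t; rewrite lee_fin word_mass_ge0.
have [c cE] : exists c : R, (\esum_(t in B) (word_mass x t)%:E = c%:E)%E.
  rewrite /B (IH (fun j => A (lift ord0 j))); elim/big_ind: _ => [|_ _ [a ->] [b ->]|j _].
  - by exists 1.
  - by exists (a * b).
  exists (fine (\esum_(i in A (lift ord0 j)) (x i)%:E)%E); rewrite fineK//.
  rewrite ge0_fin_numE; last by apply: esum_ge0 => i _; rewrite lee_fin mass_ge0.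
  rewrite (le_lt_trans _ (ltry 1))// -(mass_sum1 x) esum_mkcond.
  by apply: le_esum => i _; case: ifP; rewrite // lee_fin mass_ge0.
rewrite cE esumZ; first by rewrite muleC.
  by rewrite -lee_fin -cE; apply: esum_ge0 => t _; rewrite lee_fin word_mass_ge0.
by move=> i; rewrite lee_fin mass_ge0.
Qed.

Section IidProbability.
Variables (x : ddistr R I) (n : nat).

Let iid0 : (@iid x n set0 = 0)%E.
Proof. exact: esum_set0. Qed.

Let iid_ge0 A : (0 <= @iid x n A)%E.
Proof. by apply: esum_ge0 => u _; rewrite lee_fin word_mass_ge0. Qed.

Let iid_sigma_additive : semi_sigma_additive (@iid x n).
Proof.
move=> F _ tF _; rewrite /iid nneseries_sum_bigcup//; last first.
  by move=> u; rewrite lee_fin word_mass_ge0.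
by apply: is_cvg_nneseries => i _ _; exact: iid_ge0.
Qed.

HB.instance Definition _ := isMeasure.Build _ _ _ (@iid x n)
  iid0 iid_ge0 iid_sigma_additive.

Let iid_setT : (@iid x n [set: sample x n] = 1)%E.
Proof.
transitivity (iid [set u : sample x n |
    forall j, (fun=> [set: I]) j (tnth (u : n.-tuple I) j)]).
  by congr iid; apply/seteqP; split.
by rewrite (iid_rect x (fun=> setT)) big1// => j _; rewrite mass_sum1.
Qed.

HB.instance Definition _ := Measure_isProbability.Build _ _ _ (@iid x n) iid_setT.

End IidProbability.
End Words.

Lemma iid_letter (R : realType) (I : choiceType) (x : ddistr R I) n
    (j : 'I_n) (i : I) :
  iid [set u : sample x n | tnth (u : n.-tuple I) j = i] = (x i)%:E.
Proof.
pose A k := if k == j then [set i] else [set: I].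
transitivity (iid [set u : sample x n | forall k, A k (tnth (u : n.-tuple I) k)]).
  congr iid; apply/seteqP; split=> u /= uj; last first.
    by have := uj j; rewrite /A eqxx.
  by move=> k; rewrite /A; case: eqP => // ->.
rewrite (iid_rect x A) (bigD1 j)//= {1}/A eqxx esum_set1 ?lee_fin ?mass_ge0//.
by rewrite big1 ?mule1// => k /negPf kj; rewrite /A kj mass_sum1.
Qed.

Lemma iid_independent (R : realType) (I : choiceType) (x : ddistr R I) n
    (A : 'I_n -> set I) :
  (iid [set u : sample x n | forall j, A j (tnth (u : n.-tuple I) j)]
   = \prod_(j < n) iid [set u : sample x n | A j (tnth (u : n.-tuple I) j)])%E.
Proof.
rewrite (iid_rect x A); apply: eq_bigr => j _.
pose B k := if k == j then A j else [set: I].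
transitivity (iid [set u : sample x n | forall k, B k (tnth (u : n.-tuple I) k)]).
  rewrite (iid_rect x B) (bigD1 j)//= {1}/B eqxx.
  by rewrite big1 ?mule1// => k /negPf kj; rewrite /B kj mass_sum1.
congr iid; apply/seteqP; split=> u /= uj.
  by have := uj j; rewrite /B eqxx.
by move=> k; rewrite /B; case: eqP => // ->.
Qed.

Section Standardization.
Context {d : Order.disp_t} {I : orderType d} {n : nat}.

(* Zero-based value of the standardization at position p: the letters smaller
   than u_p come first, then the occurrences of u_p to the left of p. *)
Definition std_val (u : n.-tuple I) (p : 'I_n) : nat :=
  (count (fun i => (i < tnth u p)%O) u + count_mem (tnth u p) (take p u))%N.

Lemma count_lt_mem (s : seq I) a :
  (count (fun i => (i < a)%O) s + count_mem a s
   = count (fun i => (i <= a)%O) s)%N.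
Proof.
elim: s => //= b s <-; rewrite addnACA le_eqVlt.
by congr (_ + _)%N; case: eqVneq => [->|]; rewrite ?ltxx ?addn0.
Qed.

Lemma count_take_lt (u : n.-tuple I) (p : 'I_n) q : (p < q)%N ->
  (count_mem (tnth u p) (take p u) < count_mem (tnth u p) (take q u))%N.
Proof.
move=> pq; have pn : (p < size u)%N by rewrite size_tuple.
have -> : take q u = take p.+1 u ++ drop p.+1 (take q u).
  by rewrite -[LHS](cat_take_drop p.+1) take_takel.
rewrite count_cat (take_nth (tnth u p)) // -cats1 count_cat /=.
by rewrite -tnth_nth eqxx addn0 addn1 addSn ltnS leq_addr.
Qed.

Lemma std_val_lt_le (u : n.-tuple I) (p : 'I_n) :
  (std_val u p < count (fun i => (i <= tnth u p)%O) u)%N.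
Proof.
rewrite /std_val -count_lt_mem ltn_add2l.
by rewrite (leq_trans (count_take_lt u (ltn_ord p)))// take_oversize ?size_tuple.
Qed.

Lemma std_val_ltn (u : n.-tuple I) (p : 'I_n) : (std_val u p < n)%N.
Proof.
by rewrite (leq_trans (std_val_lt_le u p))// -[leqRHS](size_tuple u) count_size.
Qed.

Lemma std_val_inj (u : n.-tuple I) :
  injective (fun p => Ordinal (std_val_ltn u p)).
Proof.
have lt_std p q : (tnth u p < tnth u q)%O -> (std_val u p < std_val u q)%N.
  move=> pq; rewrite (leq_trans (std_val_lt_le u p))//.
  rewrite (leq_trans _ (leq_addr _ _))//.
  by apply: sub_count => i /= /le_lt_trans; apply.
have eq_std p q : tnth u p = tnth u q -> (p < q)%N ->
    (std_val u p < std_val u q)%N.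
  by move=> e pq; rewrite /std_val -e ltn_add2l count_take_lt.
move=> p q /(congr1 val)/= e.
case: (ltgtP (tnth u p) (tnth u q)) => [/lt_std|/lt_std|pq].
- by rewrite e ltnn.
- by rewrite e ltnn.
case: (ltngtP p q) => [/(eq_std _ _ pq)|/(eq_std _ _ (esym pq))|/val_inj//].
- by rewrite e ltnn.
- by rewrite e ltnn.
Qed.

Definition std (u : n.-tuple I) : 'S_n := perm (@std_val_inj u).

End Standardization.

Example std_example :
  [seq (std [tuple 3; 1; 1; 4; 3; 1]%N p).+1 | p : 'I_6] = [:: 4; 1; 2; 6; 5; 3]%N.
Proof.
rewrite /image_mem (@eq_map _ _ _ (fun p => (std_val [tuple 3; 1; 1; 4; 3; 1]%N p).+1)).
  by rewrite !enum_ordSl (size0nil (size_enum_ord 0)); vm_compute.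
by move=> p; rewrite permE.
Qed.

HB.instance Definition _ n := isPointed.Build (perm_type 'I_n) 1%g.
HB.instance Definition _ n := @isMeasurable.Build default_measure_display
  (perm_type 'I_n) discrete_measurable discrete_measurable0
  discrete_measurableC discrete_measurableU.

Section QS.
Context {R : realType} {d : Order.disp_t} {I : orderType d}.
Variables (x : ddistr R I) (n : nat).

Definition std_rv (u : sample x n) : 'S_n := std (u : n.-tuple I).

Let std_rv_measurable : measurable_fun [set: sample x n] std_rv.
Proof. by []. Qed.

HB.instance Definition _ :=
  isMeasurableFun.Build _ _ _ _ std_rv std_rv_measurable.

Definition QS : probability 'S_n R := distribution (@iid R I x n) std_rv.

End QS.
Arguments QS {R d I} x n.

(* Positions are 0-based as elements of 'I_n but a subset of {1, ..., n-1} is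
   encoded as a set of ordinals i : 'I_n with val i equal to the element itself
   (so 0 never belongs to it). Thus i is a descent of w = w_1 ... w_n iff
   w_i > w_(i+1), where w_i and w_(i+1) are the images of i-1 and i. *)
Definition descents n (w : 'S_n) : {set 'I_n} :=
  [set i : 'I_n | [exists j : 'I_n, (j.+1 == i :> nat) && (w i < w j)%N]].

Definition is_composition (n : nat) (a : seq nat) : bool :=
  all (fun m => 0 < m)%N a && (sumn a == n).

(* S_a, for a composition a of n *)
Definition partial_sums n (a : seq nat) : {set 'I_n} :=
  [set i : 'I_n | [exists k : 'I_(size a), (0 < k)%N && (sumn (take k a) == i)]].

(* The successive differences of 0 < s_1 < ... < s_k < n, where the s_i are the
   elements of S. *)
Definition comp_of_set n (S : {set 'I_n}) : seq nat :=
  pairmap (fun a b => b - a)%N 0%N (rcons [seq val i | i <- enum S] n).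

Definition co n (w : 'S_n) : seq nat := comp_of_set (descents w).

(* [comp_of_set S] is the only composition a of n with S_a = S. *)
Section CompOfSet.

Let vals n (S : {set 'I_n}) : seq nat := [seq val i | i <- enum S].

Let scanl_mem (a : seq nat) m :
  (m \in scanl addn 0%N a) =
  [exists k : 'I_(size a).+1, (0 < k)%N && (sumn (take k a) == m)].
Proof.
have foldlE (s : seq nat) z : foldl addn z s = (z + sumn s)%N.
  by elim: s z => [|b s IH] z /=; rewrite ?addn0// IH addnA.
apply/(nthP 0%N)/existsP => [[k]|[k /andP[k0 /eqP <-]]].
  rewrite size_scanl => ka <-; have ka' : (k.+1 < (size a).+1)%N by [].
  by exists (Ordinal ka') => /=; rewrite nth_scanl// foldlE.
have ka : (k.-1 < size a)%N by rewrite prednK// -ltnS.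
by exists k.-1; rewrite ?size_scanl// nth_scanl// foldlE prednK.
Qed.

Let path_scanl z (a : seq nat) :
  all (fun m => 0 < m)%N a -> path ltn z (scanl addn z a).
Proof.
elim: a z => //= b a IH z /andP[b0 a0]; rewrite IH// andbT.
by rewrite -[X in (X < _)%N]addn0 ltn_add2l.
Qed.

Let vals_sorted n (S : {set 'I_n}) : sorted ltn (vals S).
Proof.
rewrite /vals (_ : enum S = [seq i <- enum 'I_n | i \in S]); last first.
  by rewrite enumT.
rewrite sorted_map; apply: sorted_filter; first by move=> ? ? ?; exact: ltn_trans.
by rewrite -sorted_map val_enum_ord iota_ltn_sorted.
Qed.

Let vals_inj n : injective (@vals n).
Proof.
move=> S T /(inj_map val_inj) ST; apply/setP => i.
by rewrite -mem_enum ST mem_enum.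
Qed.

Let path_rcons_vals n (S : {set 'I_n}) : (0 < n)%N ->
  (forall i, i \in S -> 0 < i)%N -> path ltn 0%N (rcons (vals S) n).
Proof.
move=> n0 S0; rewrite rcons_path; apply/andP; split.
  rewrite path_min_sorted; first exact: vals_sorted.
  by apply/allP => k /mapP[i]; rewrite mem_enum => /S0 i0 ->.
have := mem_last 0%N (vals S); rewrite inE => /orP[/eqP ->//|/mapP[i _ ->]].
exact: ltn_ord.
Qed.

Let scanl_pairmap z (s : seq nat) : path ltn z s ->
  scanl addn z (pairmap (fun a b => b - a)%N z s) = s.
Proof.
elim: s z => //= b s IH z /andP[/ltnW zb ps].
by rewrite subnKC// IH.
Qed.

Let scanl_partial_sums n (a : seq nat) : (0 < n)%N -> is_composition n a ->
  scanl addn 0%N a = rcons (vals (partial_sums n a)) n.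
Proof.
move=> n0 /andP[a0 /eqP an].
have ps_gt0 i : i \in partial_sums n a -> (0 < i)%N.
  rewrite inE => /existsP[k /andP[k0 /eqP <-]].
  case: a a0 {an} k k0 => [|b a] /=; first by move=> _ [].
  by move=> /andP[b0 _] [[|k] ?]//= _; rewrite addn_gt0 b0.
apply: (irr_sorted_eq ltn_trans ltnn).
- exact: path_sorted (path_scanl 0 a0).
- exact: path_sorted (path_rcons_vals n0 ps_gt0).
move=> m; rewrite scanl_mem mem_rcons inE; apply/existsP/orP.
  move=> [k /andP[k0 /eqP km]].
  have [ka|ak] := ltnP k (size a); last first.
    by left; rewrite -km take_oversize// an.
  right; have mn : (m < n)%N.
    have : (0 < sumn (drop k a))%N.
      rewrite (drop_nth 0%N ka) /= addn_gt0.
      by have /allP/(_ _ (mem_nth 0%N ka)) -> := a0.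
    have := congr1 sumn (cat_take_drop k a).
    by rewrite sumn_cat km an => <- d0; rewrite -addn1 leq_add2l.
  apply/mapP; exists (Ordinal mn) => //; rewrite mem_enum inE.
  by apply/existsP; exists (Ordinal ka); rewrite /= k0 km eqxx.
move=> [/eqP ->|/mapP[i]].
  exists ord_max; rewrite /= take_size an eqxx andbT.
  by case: (a) an n0 => //= <-.
rewrite mem_enum inE => /existsP[k /andP[k0 /eqP ki]] ->.
by exists (widen_ord (leqnSn _) k); rewrite /= k0 ki eqxx.
Qed.

Lemma is_composition_comp_of_set n (S : {set 'I_n}) : (0 < n)%N ->
  (forall i, i \in S -> 0 < i)%N -> is_composition n (comp_of_set S).
Proof.
move=> n0 S0; have pS := path_rcons_vals n0 S0.
have pos z s : path ltn z s ->
    all (fun m => 0 < m)%N (pairmap (fun a b => b - a)%N z s).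
  elim: s z => //= b s IH z /andP[zb ps].
  by rewrite subn_gt0 zb IH.
have sum z s : path ltn z s ->
    (z + sumn (pairmap (fun a b => b - a) z s) = last z s)%N.
  elim: s z => [z _|b s IH z /andP[/ltnW zb ps]] /=; first by rewrite addn0.
  by rewrite addnA subnKC// IH.
by rewrite /is_composition pos//= -[sumn _]add0n sum// last_rcons.
Qed.

Lemma partial_sums_comp_of_set n (S : {set 'I_n}) : (0 < n)%N ->
  (forall i, i \in S -> 0 < i)%N -> partial_sums n (comp_of_set S) = S.
Proof.
move=> n0 S0; apply: vals_inj.
have := scanl_partial_sums n0 (is_composition_comp_of_set n0 S0).
rewrite scanl_pairmap; last exact: path_rcons_vals.
by move=> /rcons_inj[].
Qed.

Lemma comp_of_set_partial_sums n (a : seq nat) : (0 < n)%N ->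
  is_composition n a -> comp_of_set (partial_sums n a) = a.
Proof.
move=> n0 an; rewrite /comp_of_set -scanl_partial_sums//.
by apply: scanlK => m; exact: addKn.
Qed.

End CompOfSet.

Lemma co_is_composition n (w : 'S_n) : (0 < n)%N -> is_composition n (co w).
Proof.
move=> n0; apply: is_composition_comp_of_set => // i.
by rewrite inE => /existsP[j /andP[/eqP <-]].
Qed.

Lemma coP n (w : 'S_n) (a : seq nat) : (0 < n)%N -> is_composition n a ->
  partial_sums n a = descents w <-> a = co w.
Proof.
move=> n0 an; split=> [wa|->].
  by rewrite /co -wa comp_of_set_partial_sums.
apply: partial_sums_comp_of_set => // i.
by rewrite inE => /existsP[j /andP[/eqP <-]].
Qed.

Section Fundamental.
Context {R : realType} {d : Order.disp_t} {I : orderType d}.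

(* For n > 0 and a composition a of n. The j-th letter (1-based) of u is
   [tnth u i] with i.+1 = j, and [tnth u j] is the next one. *)
Definition fundamental (x : I -> R) n (a : seq nat) : \bar R :=
  (\esum_(u in [set u : n.-tuple I | forall i j : 'I_n, i.+1 = j ->
       (tnth u i <= tnth u j)%O /\
       (j \in partial_sums n a -> (tnth u i < tnth u j)%O)])
     (\prod_(j < n) x (tnth u j))%:E)%E.

End Fundamental.

(* Main.v *)
Require Import Defs.
From mathcomp Require Import all_boot all_order all_algebra all_fingroup.
From mathcomp Require Import all_classical all_reals all_analysis.

(** The standardization numbers the positions [p] of a word [u] in increasing
    lexicographic order of [(u_p, p)]. Hence [w] is the standardization of [u]
    iff the pairs [(u_p, p)], listed for [p = w^-1 0, w^-1 1, ...], strictly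
    increase: the rearranged word [v = u \o w^-1] is weakly increasing, and it
    increases strictly wherever [w^-1] descends. Rearranging letters does not
    change the mass of a word. *)

Import Order.TTheory.

Section Standardization.
Context {d : Order.disp_t} {I : orderType d} {n : nat}.
Implicit Types (u v : n.-tuple I) (p q : 'I_n) (s w : 'S_n).

(** If [u_p < u_q], all letters up to [u_p] count towards [std_val u q]; between equal letters the
    prefix count decides. The pairs (letter, position) are totally ordered, so these two
    implications also yield the converse. *)
Lemma std_ltn u p q :
  (std u p < std u q)%N =
  (tnth u p < tnth u q)%O || ((tnth u p == tnth u q) && (p < q)%N).
Proof.
have lt_std a b : (tnth u a < tnth u b)%O -> (std_val u a < std_val u b)%N.
  move=> ab; apply: leq_trans (std_val_lt_le u a) _.
  apply: leq_trans (leq_addr _ _).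
  by apply: sub_count => i /= /le_lt_trans; apply.
have eq_std a b : tnth u a = tnth u b -> (a < b)%N ->
    (std_val u a < std_val u b)%N.
  by move=> e ab; rewrite /std_val -e ltn_add2l count_take_lt.
rewrite !permE /=; case: (ltgtP (tnth u p) (tnth u q)) => [/lt_std //|/lt_std|e].
  by move=> /ltnW; rewrite ltnNge => ->.
case: (ltngtP p q) => [/(eq_std _ _ e) //|/(eq_std _ _ (esym e))|/val_inj ->] /=.
  by move=> /ltnW; rewrite ltnNge => ->.
exact: ltnn.
Qed.

(** Each step raises [s] by at least 1. Counting from position 0 gives [i <= s i]; counting from [i]
    up to position [n.-1], whose value is at most [n.-1], gives [s i <= i]. *)
Lemma perm_increasing_eq1 s :
  (forall i j : 'I_n, i.+1 = j -> (s i < s j)%N) -> s = 1%g.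
Proof.
move=> s_incr.
have gap m (i j : 'I_n) : (j = i + m :> nat)%N -> (s i + m <= s j)%N.
  elim: m j => [|m IH] j jE.
    by rewrite addn0 in jE; rewrite addn0 (val_inj jE) leqnn.
  have lt_im : (i + m < n)%N by rewrite (leq_trans _ (ltn_ord j))// jE addnS ltnS.
  rewrite addnS; apply: leq_ltn_trans (IH (Ordinal lt_im) erefl) _.
  by apply: s_incr; rewrite jE addnS.
apply/permP => i; rewrite perm1; apply/val_inj/eqP; rewrite eqn_leq.
have n_gt0 : (0 < n)%N by exact: leq_ltn_trans (ltn_ord i).
have lt_max : (n.-1 < n)%N by rewrite prednK.
have le_i_max : (i <= n.-1)%N by rewrite -ltnS prednK.
apply/andP; split.
  have s_max : (s (Ordinal lt_max) <= n.-1)%N by rewrite -ltnS prednK.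
  have := leq_trans (gap (n.-1 - i)%N i (Ordinal lt_max) (esym (subnKC le_i_max))) s_max.
  by rewrite -[leqRHS](subnKC le_i_max) leq_add2r.
exact: leq_trans (leq_addl _ _) (gap i (Ordinal n_gt0) i erefl).
Qed.

(** Composition with [w] takes the sorted word [v] back to [u]; sorting [u] is
    [permute_word w^-1]. *)
Definition permute_word w u : n.-tuple I := [tuple tnth u (w p) | p < n].

Lemma permute_wordK w : cancel (permute_word w) (permute_word w^-1%g).
Proof. by move=> u; apply: eq_from_tnth => p; rewrite !tnth_mktuple permKV. Qed.

Lemma permute_wordVK w : cancel (permute_word w^-1%g) (permute_word w).
Proof. by move=> u; apply: eq_from_tnth => p; rewrite !tnth_mktuple permK. Qed.

Lemma word_mass_permute (R : realType) (x : I -> R) w u :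
  word_mass x (permute_word w u) = word_mass x u.
Proof.
rewrite /word_mass [RHS](reindex_inj (@perm_inj _ w)) /=.
by apply: eq_bigr => j _; rewrite tnth_mktuple.
Qed.

Lemma succ_descents w (i j : 'I_n) : i.+1 = j ->
  (j \in descents w) = (w j < w i)%N.
Proof.
move=> ij; rewrite inE; apply/existsP/idP => [[k /andP[/eqP kj]]|ji].
  by rewrite -ij in kj; case: kj => /val_inj ->.
by exists i; rewrite ij eqxx.
Qed.

Lemma std_permute_wordP w v :
  std (permute_word w v) = w <->
  (forall i j : 'I_n, i.+1 = j -> (tnth v i <= tnth v j)%O /\
     (j \in descents w^-1%g -> (tnth v i < tnth v j)%O)).
Proof.
set u := permute_word w v.
have tnth_u i : tnth u (w^-1%g i) = tnth v i by rewrite tnth_mktuple permKV.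
split=> [stdE i j ij|v_incr].
  (* The positions [w^-1 i] and [w^-1 j] carry the consecutive values [i] and [j]. *)
  have : (std u (w^-1%g i) < std u (w^-1%g j))%N by rewrite stdE !permKV ij.
  rewrite std_ltn !tnth_u (succ_descents _ _ _ ij).
  by case: ltgtP => //= _; case: ltngtP.
(* Products of permutations act left factor first, so [w^-1 * std u] sends [i] to [std u (w^-1 i)];
   it remains to see that this increases. *)
apply/esym/eqP; rewrite eq_mulVg1; apply/eqP/perm_increasing_eq1 => i j ij.
have [v_le v_lt] := v_incr _ _ ij.
rewrite !permM std_ltn !tnth_u; move: v_le; rewrite le_eqVlt.
move: v_lt; rewrite (succ_descents _ _ _ ij).
(* Without a descent, position breaks a possible tie of letters; at a descent the letters differ
   strictly; equal positions would force [i = j]. *)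
case: (ltngtP (w^-1%g i) (w^-1%g j)) => [||/val_inj/perm_inj].
- by rewrite andbT orbC.
- by move=> _ /(_ isT) ->.
- by move=> e; move: ij; rewrite e => /eqP; rewrite eqn_leq ltnn.
Qed.

End Standardization.

Theorem theorem2p1 (R : realType) (d : Order.disp_t) (I : orderType d)
    (x : ddistr R I) (n : nat) (n_gt0 : (0 < n)%N) (w : 'S_n) :
  QS x n [set w]%classic = fundamental x n (co (w^-1)%g).
Proof.
have descE : partial_sums n (co w^-1%g) = descents w^-1%g.
  by apply/(coP _ n_gt0); first exact: co_is_composition.
rewrite /QS /distribution /pushforward /= /iid /fundamental descE.
(* [permute_word w] maps the words indexing the fundamental series bijectively onto the words that
   standardize to [w]. *)
rewrite (@reindex_esum R _ _ [set v : n.-tuple I | forall i j : 'I_n,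
    i.+1 = j -> (tnth v i <= tnth v j)%O /\
    (j \in descents w^-1%g -> (tnth v i < tnth v j)%O)]%classic _ (permute_word w)).
  by apply: eq_esum => v _; rewrite word_mass_permute.
split=> [v /std_permute_wordP //|v v' _ _|u /= uw].
  exact: (can_inj (permute_wordK w)).
exists (permute_word w^-1%g u); last exact: permute_wordVK.
by apply/std_permute_wordP; rewrite permute_wordVK.
Qed.
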